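(* Let $\mathcal{D}$ be a dyadic grid on $\mathbb{R}$ and let $0<s<\frac12$. Then $H^s_{\mathcal{D}}(\mathbb{R})\subseteq L^{\frac{2}{1-2s}}(\mathbb{R})$. In particular, with $q:=\frac{2}{1-2s}$, there is a constant $C_s>0$ depending only on $s$ such that $$\|f\|_{L^q(\mathbb{R},dx)}\leq C_s\|f\|_{\dot H^s_{\mathcal{D}}(\mathbb{R})}$$ for any $f\in\mathscr{S}_{\mathcal{D}}(\mathbb{R})$.
   Context: A dyadic grid $\mathcal{D}$ on $\mathbb{R}$ is a collection of intervals such that: (D1) every $I\in\mathcal{D}$ has length $2^k$ for some $k\in\mathbb{Z}$; (D2) for any fixed $k_0\in\mathbb{Z}$, the intervals of $\mathcal{D}$ of length $2^{k_0}$ form a partition of $\mathbb{R}$; (D3) $I\cap J\in\{\varnothing,I,J\}$ for all $I,J\in\mathcal{D}$. $|\cdot|$ denotes Lebesgue measure. For $I\in\mathcal{D}$, $I_+$ and $I_-$ denote the right and left halves of $I$ (the two elements of $\mathcal{D}$ of length $|I|/2$ contained in $I$), and $h_I:=|I|^{-1/2}(\mathbf{1}_{I_+}-\mathbf{1}_{I_-})$ is the Haar function; $\{h_I\}_{I\in\mathcal{D}}$ is an orthonormal basis of $L^2(\mathbb{R})$. $\mathscr{S}_{\mathcal{D}}(\mathbb{R})$ is the linear span of $\{h_I: I\in\mathcal{D}\}$. Functions are real-valued and $(f,g):=\int_{\mathbb{R}}fg\,dx$. Put $D^s_{\mathcal{D}}f:=\sum_{I\in\mathcal{D}}|I|^{-s}(f,h_I)h_I$,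 $$\|f\|_{\dot H^s_{\mathcal{D}}(\mathbb{R})}:=\|D^s_{\mathcal{D}}f\|_{L^2(\mathbb{R})}=\Big(\sum_{I\in\mathcal{D}}|I|^{-2s}|(f,h_I)|^2\Big)^{1/2},$$ and $H^s_{\mathcal{D}}(\mathbb{R}):=\{f\in L^2(\mathbb{R}): D^s_{\mathcal{D}}f\in L^2(\mathbb{R})\}$, i.e. the set of $f\in L^2(\mathbb{R})$ for which the sum $\sum_{I\in\mathcal{D}}|I|^{-2s}|(f,h_I)|^2$ is finite. *)

(* Defs.v *)
From HB Require Import structures.
From mathcomp Require Import all_boot all_order all_algebra.
From mathcomp Require Import all_classical all_reals all_analysis.

Set Implicit Arguments.
Unset Strict Implicit.
Unset Printing Implicit Defensive.

Import Order.TTheory GRing.Theory Num.Theory.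
Import numFieldNormedType.Exports.

Local Open Scope classical_set_scope.
Local Open Scope ring_scope.

Definition leb (R : realType) : {measure set (measurableTypeR R) -> \bar R} :=
  lebesgue_measure.

Definition len (R : realType) (I : set R) : R := fine (leb R I).

(* [is_interval] does not prescribe which endpoints belong to an interval, and
   neither does the definition of a dyadic grid. *)
Definition dyadic_grid (R : realType) (D : set (set R)) : Prop :=
  [/\ forall I, D I ->
        is_interval I /\ exists k : int, leb R I = (2 ^ k)%:E,
      forall k : int, partition [set I | D I /\ leb R I = (2 ^ k)%:E] id setT
    & forall I J, D I -> D J ->
        [\/ I `&` J = set0, I `&` J = I | I `&` J = J]].

(* In a dyadic grid each I in D has exactly two members of D of length |I| / 2
   inside it; they are disjoint intervals covering I, so the order of the points
   of J and I \ J tells them apart, and the default value set0 is not used. *)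
Definition right_half (R : realType) (D : set (set R)) (I : set R) : set R :=
  xget set0 [set J | [/\ D J, J `<=` I, len J = len I / 2
    & forall y z, (I `\` J) y -> J z -> y < z]].

Definition left_half (R : realType) (D : set (set R)) (I : set R) : set R :=
  xget set0 [set J | [/\ D J, J `<=` I, len J = len I / 2
    & forall y z, J y -> (I `\` J) z -> y < z]].

Definition haar (R : realType) (D : set (set R)) (I : set R) : R -> R :=
  fun x => len I `^ (- 2^-1) * (\1_(right_half D I) x - \1_(left_half D I) x).

Definition inner (R : realType) (f g : R -> R) : R :=
  Rintegral (leb R) setT (fun x => f x * g x).

Definition haar_span (R : realType) (D : set (set R)) : set (R -> R) :=
  [set f | exists (n : nat) (I : 'I_n -> set R) (c : 'I_n -> R),
    (forall i, D (I i)) /\ f = (fun x => \sum_(i < n) c i * haar D (I i) x)].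

(* The square of the homogeneous norm below; the sum over the (countable) grid
   is unordered and takes values in [0, +oo]. *)
Definition haar_energy (R : realType) (D : set (set R)) (s : R) (f : R -> R) :
    \bar R :=
  \esum_(I in D) (len I `^ (- (2 * s)) * `|inner f (haar D I)| ^+ 2)%:E.

Definition hdot_norm (R : realType) (D : set (set R)) (s : R) (f : R -> R) :
    \bar R :=
  (haar_energy D s f `^ 2^-1)%E.

Definition Hs (R : realType) (D : set (set R)) (s : R) : set (R -> R) :=
  [set f | f \in Lfun (leb R) 2%:E /\ (haar_energy D s f < +oo)%E].

(* Main.v *)
Require Import Defs.
From mathcomp Require Import all_boot all_order all_algebra.
From mathcomp Require Import all_classical all_reals all_analysis.
From mathcomp Require Import measurable_realfun ring lra.

(** Both assertions follow from one inequality, valid for every [f] in L^2: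
    the L^q norm of [f] is at most [sobolev_const s] times its homogeneous
    dyadic Sobolev norm ([sobolev_hdot]); functions in the span of the Haar
    functions are in L^2 ([haar_span_Lfun2]).  The argument is Hedberg's,
    transported to the dyadic setting.

    Fix [x], let [I_k] be the interval of length 2^k of the grid that contains
    [x], and let [A_k] be the average of [f] over [I_k].  Since [I_(k-1)] is
    one of the two halves of [I_k], the consecutive averages differ by exactly
    |I_k|^(-1/2) |(f, h_(I_k))| ([average_increment]).  As k goes to +oo the
    averages tend to 0 because [f] is in L^2 ([average_cvg0]); as k goes to -oo
    they tend to [f x] for almost every [x], by Lebesgue's differentiation
    theorem along the nicely shrinking sets [I_k] ([ae_average_cvg]).  So
    |f x| is at most the sum over k of the increments.

    The increments have two bounds.  Let E be the energy, i.e. the square of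
    the homogeneous norm, and spread the term of each interval I of E uniformly
    over I; this gives a function W ([energy_density]) whose integral is E, by
    Tonelli's theorem over the countable grid ([energy_density_integral]).
    Keeping one term of W at the point [x] bounds the k-th increment by
    2^(ks) W(x)^(1/2), and keeping one term of E bounds it by
    2^(k(s-1/2)) E^(1/2).  The first bound is summable towards k = -oo and the
    second towards k = +oo; cutting at the scale where they agree gives
    |f x| <= C W(x)^((1-2s)/2) E^s ([dyadic_interpolation],
    [sobolev_pointwise]).  With q = 2/(1-2s), raising to the power q makes the
    right-hand side linear in W, and integrating gives
    ||f||_q^q <= C^q E^(sq) E = C^q E^(q/2) ([sobolev_Lnorm_le]). *)

Set Implicit Arguments.
Unset Strict Implicit.
Unset Printing Implicit Defensive.

Import Order.TTheory GRing.Theory Num.Theory.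
Import numFieldNormedType.Exports.

Local Open Scope classical_set_scope.
Local Open Scope ring_scope.

(** * Interpolating between two geometric bounds on the increments *)

(** Comparison with the sum of the geometric series of the increments. *)
Lemma geometric_increments_cvg (R : realType) (u : R^nat) (l a r : R) :
  0 <= a -> 0 < r -> r < 1 ->
  (forall n, `|u n - u n.+1| <= a * r ^+ n) -> u @ \oo --> l ->
  `|u 0 - l| <= a / (1 - r).
Proof.
move=> a0 r0 r1 du ul.
have r1' : 0 < 1 - r by rewrite subr_gt0.
have le n : `|u 0 - u n| <= a / (1 - r) * (1 - r ^+ n).
  elim: n => [|n IHn]; first by rewrite subrr normr0 expr0 subrr mulr0.
  rewrite -(subrKA (u n)) (le_trans (ler_normD _ _))//.
  rewrite (le_trans (lerD IHn (du n)))// le_eqVlt; apply/orP; left; apply/eqP.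
  by rewrite exprS; field; rewrite gt_eqF.
have : `|u 0 - u n| @[n --> \oo] --> `|u 0 - l|.
  by apply: cvg_norm; apply: cvgB => //; exact: cvg_cst.
move=> /cvg_lim <- //; apply: limr_le.
  by apply/cvg_ex; exists `|u 0 - l|; apply: cvg_norm; apply: cvgB => //;
    exact: cvg_cst.
apply: nearW => n; rewrite (le_trans (le n))// ler_piMr//.
  by rewrite divr_ge0// ltW.
by rewrite gerBl exprn_ge0// ltW.
Qed.

Lemma dyadic_floor (R : realType) (T : R) : 0 < T ->
  exists N : int, 2 ^ N <= T /\ T <= 2 ^ (N + 1).
Proof.
move=> T0; have l2 : 0 < ln 2 :> R by rewrite ln_gt0// ltr1n.
have [x ->] : exists x : R, T = 2 `^ x.
  exists (ln T / ln 2).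
  by rewrite /powR pnatr_eq0/= divfK ?gt_eqF// lnK.
have /andP[fx /ltW xf] := floor_itv x.
by exists (Num.floor x); rewrite -!powR_intmul//; split;
  apply: ler_powR; rewrite ?ler1n.
Qed.

(** The sums of the two geometric series: the downward one, of ratio [2^-s],
    and the upward one, of ratio [2^(s - 1/2)]. *)
Definition sobolev_const (R : realType) (s : R) : R :=
  (1 - 2 `^ (- s))^-1 + (1 - 2 `^ (s - 2^-1))^-1.

Lemma powR2_lt1 (R : realType) (t : R) : t < 0 -> 2 `^ t < 1.
Proof.
by move=> t0; rewrite /powR pnatr_eq0/= expR_lt1 nmulr_rlt0// ln_gt0// ltr1n.
Qed.

Lemma sobolev_const_gt0 (R : realType) (s : R) : 0 < s -> s < 2^-1 ->
  0 < sobolev_const s.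
Proof.
move=> s0 s1; rewrite addr_gt0// invr_gt0 subr_gt0 powR2_lt1// ?oppr_lt0//.
by rewrite subr_lt0.
Qed.

Lemma dyadic_powR (R : realType) (M : int) (n : nat) (t : R) :
  (2 ^ (M + n%:Z)) `^ t = (2 ^ M) `^ t * (2 `^ t) ^+ n.
Proof.
rewrite -!powR_intmul// -powR_mulrn ?powR_ge0// -!powRrM.
by rewrite -powRD ?pnatr_eq0 ?implybT// intrD mulrDl (mulrC t).
Qed.

Lemma dyadic_powRN (R : realType) (M : int) (n : nat) (t : R) :
  (2 ^ (M - n%:Z)) `^ t = (2 ^ M) `^ t * (2 `^ (- t)) ^+ n.
Proof.
rewrite -!powR_intmul// -powR_mulrn ?powR_ge0// -!powRrM.
by rewrite -powRD ?pnatr_eq0 ?implybT// intrB mulrBl mulNr (mulrC t).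
Qed.

(** The two bounds on the increments agree at the scale [T = (e / G)^2].  The
    downward series starts at a power of 2 not above [T], and uses the first
    bound; the upward series starts at the next power of 2, not below [T], and
    uses the second one.  As [s > 0] and [s - 1/2 < 0], replacing each of
    these powers of 2 by [T] only enlarges the corresponding bound. *)
Lemma dyadic_interpolation (R : realType) (s G e l : R) (A : int -> R) :
  0 < s -> s < 2^-1 -> 0 < G -> 0 < e ->
  (forall k : int, `|A (k - 1) - A k| <= G * (2 ^ k) `^ s) ->
  (forall k : int, `|A (k - 1) - A k| <= e * (2 ^ k) `^ (s - 2^-1)) ->
  (forall N : int, A (N - n%:Z) @[n --> \oo] --> l) ->
  (forall N : int, A (N + n%:Z) @[n --> \oo] --> 0) ->
  `|l| <= sobolev_const s * (G `^ (1 - 2 * s) * e `^ (2 * s)).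
Proof.
move=> s0 s1 G0 e0 dG de Al A0.
have T0 : 0 < (e / G) `^ 2 by rewrite powR_gt0// divr_gt0.
have [N [NT TN]] := dyadic_floor T0.
have lo : `|A N - l| <= G * (2 ^ N) `^ s / (1 - 2 `^ (- s)).
  have := @geometric_increments_cvg _ (fun n => A (N - n%:Z)) l
    (G * (2 ^ N) `^ s) (2 `^ (- s)); rewrite subr0; apply.
  - by rewrite mulr_ge0 ?powR_ge0// ltW.
  - by rewrite powR_gt0.
  - by rewrite powR2_lt1// oppr_lt0.
  - move=> n; rewrite distrC -mulrA -dyadic_powRN (le_trans _ (dG _))//.
    by rewrite -addn1 PoszD opprD addrA.
  - exact: Al.
have hi : `|A N - 0| <= e * (2 ^ (N + 1)) `^ (s - 2^-1) / (1 - 2 `^ (s - 2^-1)).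
  have := @geometric_increments_cvg _ (fun n => A (N + n%:Z)) 0
    (e * (2 ^ (N + 1)) `^ (s - 2^-1)) (2 `^ (s - 2^-1)); rewrite addr0; apply.
  - by rewrite mulr_ge0 ?powR_ge0// ltW.
  - by rewrite powR_gt0.
  - by rewrite powR2_lt1// subr_lt0.
  - move=> n; rewrite -mulrA -dyadic_powR (le_trans _ (de _))//.
    have -> : N + 1 + n%:Z = N + n%:Z + 1 by rewrite addrAC.
    by rewrite addrK -addn1 PoszD addrA.
  - exact: A0.
have TE t : ((e / G) `^ 2) `^ t = e `^ (2 * t) * G `^ (- (2 * t)).
  rewrite -powRrM powRM ?ltW ?invr_gt0//; congr (_ * _).
  by rewrite -powR_inv1 ?ltW// -powRrM mulN1r.
have lo' : G * (2 ^ N) `^ s <= G `^ (1 - 2 * s) * e `^ (2 * s).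
  rewrite powRD ?(gt_eqF G0) ?implybT// (powRr1 (ltW G0)) -mulrA ler_pM2l//.
  rewrite [leRHS]mulrC -TE ge0_ler_powR// ?nnegrE ?ltW//.
  by rewrite exprz_gt0.
have hi' : e * (2 ^ (N + 1)) `^ (s - 2^-1) <= G `^ (1 - 2 * s) * e `^ (2 * s).
  have -> : G `^ (1 - 2 * s) * e `^ (2 * s) = e * ((e / G) `^ 2) `^ (s - 2^-1).
    rewrite TE mulrBr mulfV// opprB mulrA.
    rewrite -[X in _ = X * _ * _](powRr1 (ltW e0)).
    by rewrite -powRD ?(gt_eqF e0) ?implybT// subrKC mulrC.
  rewrite ler_pM2l// -[s - _]opprB 2!powRN.
  rewrite lef_pV2 ?posrE ?powR_gt0 ?divr_gt0 ?exprz_gt0//.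
  by rewrite ge0_ler_powR// ?nnegrE ?subr_ge0 ?ltW// exprz_gt0.
rewrite -(subrK (A N) l) (le_trans (ler_normD _ _))// distrC.
rewrite /sobolev_const mulrDl lerD//.
  rewrite (le_trans lo)// mulrC ler_wpM2l// invr_ge0 subr_ge0 ltW//.
  by rewrite powR2_lt1// oppr_lt0.
rewrite subr0 in hi; rewrite (le_trans hi)// mulrC ler_wpM2l//.
by rewrite invr_ge0 subr_ge0 ltW// powR2_lt1// subr_lt0.
Qed.

(** * Geometry of a dyadic grid *)

Section grid.
Context (R : realType) (D : set (set R)) (gD : dyadic_grid D).
Implicit Types (I J : set R) (k : int) (x : R).

Lemma grid_interval I : D I -> is_interval I.
Proof. by case: gD => + _ _ => /[apply] -[]. Qed.

Lemma grid_measurable I : D I -> measurable (I : set (measurableTypeR R)).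
Proof. by move=> /grid_interval; exact: is_interval_measurable. Qed.

Lemma grid_level I : D I -> exists k : int, leb R I = (2 ^ k)%:E.
Proof. by case: gD => + _ _ => /[apply] -[]. Qed.

Lemma pow2_gt0 k : 0 < 2 ^ k :> R.
Proof. by rewrite exprz_gt0. Qed.

Lemma level_len I k : leb R I = (2 ^ k)%:E -> len I = 2 ^ k.
Proof. by rewrite /len => ->. Qed.

Lemma grid_neq0 I : D I -> I !=set0.
Proof.
move=> DI; have [k Ik] := grid_level DI.
by case: gD => _ /(_ k)[_ _ +] _; apply.
Qed.

Lemma grid_level_inj I J k x : D I -> D J ->
  leb R I = (2 ^ k)%:E -> leb R J = (2 ^ k)%:E -> I x -> J x -> I = J.
Proof.
move=> DI DJ Ik Jk Ix Jx; case: gD => _ /(_ k)[_ + _] _.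
by move=> /(_ I J); apply => //; exists x.
Qed.

(** If [J] is not inside [I], the grid property leaves only [I] inside [J]; then
    the measures agree, so both intervals belong to the same level and they
    coincide. *)
Lemma grid_nested I J x : D I -> D J -> (leb R J <= leb R I)%E ->
  I x -> J x -> J `<=` I.
Proof.
move=> DI DJ JI Ix Jx; have [_ _ /(_ I J DI DJ)[|IJ|<-]] := gD.
- by move/seteqP => [+ _] => /(_ x); case.
- have IsJ : I `<=` J by rewrite -IJ; apply: subIsetr.
  have [k Ik] := grid_level DI.
  suff -> : I = J by [].
  apply: (@grid_level_inj _ _ k x) => //; rewrite -Ik.
  apply/eqP; rewrite eq_le JI/=.
  by rewrite le_measure// inE; exact: grid_measurable.
- exact: subIsetl.
Qed.

Definition cell k x : set R :=
  xget set0 [set I | [/\ D I, leb R I = (2 ^ k)%:E & I x]].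

Lemma cellP k x : [/\ D (cell k x), leb R (cell k x) = (2 ^ k)%:E & cell k x x].
Proof.
apply: (@xgetPex _ set0 [set I | [/\ D I, leb R I = (2 ^ k)%:E & I x]]).
have [_ /(_ k)[+ _ _] _] := gD.
move=> /seteqP[_ /(_ x)]/= /(_ Logic.I)[I [DI Ik] Ix].
by exists I.
Qed.

Lemma cellE k x I : D I -> leb R I = (2 ^ k)%:E -> I x -> cell k x = I.
Proof.
move=> DI Ik Ix; have [Dc ck cx] := cellP k x.
exact: grid_level_inj ck _ cx _.
Qed.

Lemma pow2_half k : 2 ^ k = 2 ^ (k - 1) + 2 ^ (k - 1) :> R.
Proof.
by rewrite -[in LHS](subrK 1 k) expfzDr ?pnatr_eq0// expr1z mulr_natr mulr2n.
Qed.

(** The intervals of level [k - 1] that meet [cell k x] lie inside it.  One of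
    them does not fill it, and three of them would have total length larger
    than [2 ^ k]; so there are exactly two. *)
Lemma cell_split k x : exists J,
  [/\ D J, leb R J = (2 ^ (k - 1))%:E, cell (k - 1) x `&` J = set0 &
      cell k x = cell (k - 1) x `|` J].
Proof.
have [DI Ik Ix] := cellP k x; have [DJ Jk Jx] := cellP (k - 1) x.
set I := cell k x in DI Ik Ix *; set J := cell (k - 1) x in DJ Jk Jx *.
have half_sub K y : D K -> leb R K = (2 ^ (k - 1))%:E -> K y -> I y -> K `<=` I.
  move=> DK Kk Ky Iy; apply: (@grid_nested I K y) => //.
  by rewrite Ik Kk lee_fin [leRHS]pow2_half lerDl ltW// pow2_gt0.
have JI := half_sub J x DJ Jk Jx Ix.
have mI := grid_measurable DI; have mJ := grid_measurable DJ.
(* The other half is the interval of level [k - 1] around a point off [J]. *)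
have [y [Iy nJy]] : (I `\` J) !=set0.
  apply/set0P/eqP => IJ0.
  have IJ : I = J by apply/seteqP; split => //; rewrite -setD_eq0.
  move: Ik; rewrite IJ Jk => -[/eqP]; rewrite [eqbRHS]pow2_half.
  by rewrite -subr_eq0 opprD addrA subrr sub0r oppr_eq0 gt_eqF// pow2_gt0.
have [DK Kk Ky] := cellP (k - 1) y.
set K := cell (k - 1) y in DK Kk Ky.
have KI := half_sub K y DK Kk Ky Iy.
have disj A B z w : D A -> D B -> leb R A = (2 ^ (k - 1))%:E ->
    leb R B = (2 ^ (k - 1))%:E -> A z -> ~ B z -> A w -> B w -> False.
  move=> DA DB Ak Bk Az nBz Aw Bw; apply: nBz.
  by rewrite -(grid_level_inj DA DB Ak Bk Aw Bw).
have JK0 : J `&` K = set0.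
  by apply/seteqP; split => // z [Jz Kz]; exact: (disj K J y z).
exists K; split => //; apply/seteqP; split; last by rewrite subUset.
move=> z Iz; apply: contrapT => nz.
have [DL Lk Lz] := cellP (k - 1) z.
set L := cell (k - 1) z in DL Lk Lz.
have LI := half_sub L z DL Lk Lz Iz.
have mK := grid_measurable DK; have mL := grid_measurable DL.
have : (leb R ((J `|` K) `|` L) <= leb R I)%E.
  by rewrite le_measure ?inE//; [do !apply: measurableU|rewrite !subUset].
have JKL0 : (J `|` K) `&` L = set0.
  apply/seteqP; split => // w [JKw Lw]; case: JKw => ?.
    by apply: (disj L J z w) => //; apply: contra_not nz; left.
  by apply: (disj L K z w) => //; apply: contra_not nz; right.
have -> : leb R ((J `|` K) `|` L) = (leb R J + leb R K + leb R L)%E.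
  by rewrite measureU//; [rewrite measureU|exact: measurableU].
rewrite Ik Jk Kk Lk -!EFinD lee_fin [leRHS]pow2_half gerDl.
by rewrite leNgt pow2_gt0.
Qed.

(** Two halves in the right order are the ones selected by [left_half] and
    [right_half]: any other candidate is one of the two, and the wrong one is
    excluded by its position. *)
Lemma grid_halvesE k I A B : D I -> leb R I = (2 ^ k)%:E -> D A -> D B ->
  leb R A = (2 ^ (k - 1))%:E -> leb R B = (2 ^ (k - 1))%:E ->
  I = A `|` B -> (forall y z, A y -> B z -> y < z) ->
  right_half D I = B /\ left_half D I = A.
Proof.
move=> DI Ik DA DB Ak Bk IAB AB.
have lenI : len I / 2 = 2 ^ (k - 1) :> R.
  by rewrite (level_len Ik); have := pow2_half k; lra.
have AB0 z : A z -> B z -> False.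
  by move=> Az Bz; have := AB _ _ Az Bz; rewrite ltxx.
have IA : I `\` A = B.
  apply/seteqP; split => z; first by rewrite IAB => -[[]].
  by move=> Bz; split; [rewrite IAB; right | move=> /AB0].
have IB : I `\` B = A.
  apply/seteqP; split => z; first by rewrite IAB => -[[]].
  by move=> Az; split; [rewrite IAB; left | move=> /(AB0 _ Az)].
have dich K : D K -> K `<=` I -> len K = len I / 2 -> K = A \/ K = B.
  move=> DK KI; rewrite lenI => Kk.
  have {}Kk : leb R K = (2 ^ (k - 1))%:E.
    by have [m Km] := grid_level DK; rewrite Km -Kk (level_len Km).
  have [w Kw] := grid_neq0 DK.
  have := KI _ Kw; rewrite IAB => -[?|?]; [left|right];
    exact: (@grid_level_inj _ _ (k - 1) w).
have [a Aa] := grid_neq0 DA; have [b Bb] := grid_neq0 DB.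
have wrong_order : ~ (forall y z, B y -> A z -> y < z).
  by move=> /(_ _ _ Bb Aa) /lt_trans /(_ (AB _ _ Aa Bb)); rewrite ltxx.
split; apply: xget_unique.
- split => //; [by rewrite IAB; right|by rewrite lenI; exact: level_len|].
  by rewrite IB.
- move=> K [DK KI Kk]; have [->|->//] := dich K DK KI Kk.
  by rewrite IA => /wrong_order.
- split => //; [by rewrite IAB; left|by rewrite lenI; exact: level_len|].
  by rewrite IA.
- move=> K [DK KI Kk]; have [->//|->] := dich K DK KI Kk.
  by rewrite IB => /wrong_order.
Qed.

Lemma disjoint_itv_ordered (A B : set R) : is_interval A -> is_interval B ->
  A `&` B = set0 ->
  (forall y z, A y -> B z -> y < z) \/ (forall y z, B y -> A z -> y < z).
Proof.
move=> iA iB AB0; apply: contrapT => /not_orP[].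
move=> /existsNP[y /existsNP[z /not_implyP[Ay /not_implyP[Bz]]]].
move=> /negP; rewrite -leNgt => zy.
move=> /existsNP[y' /existsNP[z' /not_implyP[By' /not_implyP[Az']]]].
move=> /negP; rewrite -leNgt => zy'.
have nAB w : A w -> B w -> False.
  by move=> Aw Bw; have : (A `&` B) w by []; rewrite AB0.
have [zz'|/ltW z'z] := leP z z'.
  by apply: (nAB z') => //; apply: (iB _ _ Bz By'); rewrite zz'.
by apply: (nAB z) => //; apply: (iA _ _ Az' Ay); rewrite z'z.
Qed.

(** Which of the two halves holds [x] is left open: exchanging them changes the
    sign of the Haar function of [cell k x], and only the absolute value of the
    Haar coefficient matters below. *)
Lemma cell_halves k x : exists J,
  [/\ D J, cell (k - 1) x `&` J = set0, cell k x = cell (k - 1) x `|` J &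
    (right_half D (cell k x) = cell (k - 1) x /\ left_half D (cell k x) = J) \/
    (right_half D (cell k x) = J /\ left_half D (cell k x) = cell (k - 1) x)].
Proof.
have [DI Ik Ix] := cellP k x; have [DJ Jk Jx] := cellP (k - 1) x.
have [K [DK Kk JK0 IJK]] := cell_split k x.
exists K; split => //.
have [JK|KJ] :=
  disjoint_itv_ordered (grid_interval DJ) (grid_interval DK) JK0.
- by right; apply: (@grid_halvesE k).
- by left; apply: (@grid_halvesE k) => //; rewrite setUC.
Qed.

Lemma interval_rat I : is_interval I -> (0 < leb R I)%E ->
  exists q : rat, I (ratr q).
Proof.
move=> iI I0; have [a [b [Ia Ib ab]]] : exists a b, [/\ I a, I b & a < b].
  apply: contrapT => nab; move: I0; rewrite ltNge => /negP; apply.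
  have [->|/set0P[a Ia]] := eqVneq I set0; first by rewrite measure0.
  rewrite (_ : I = [set a]) ?[leLHS]lebesgue_measure_set1//.
  apply/seteqP; split => [b Ib|b ->//] /=; apply: contrapT => /eqP.
  by rewrite neq_lt => /orP[?|?]; apply: nab; [exists b, a|exists a, b].
have [q] := rat_in_itvoo ab; rewrite in_itv/= => /andP[aq qb].
by exists q; apply: (iI a b) => //; rewrite !ltW.
Qed.

(** A rational point of an interval and its level determine the interval. *)
Lemma grid_countable : countable D.
Proof.
have [f fD] : {f : set R -> int * rat & forall I, D I ->
    leb R I = (2 ^ (f I).1)%:E /\ I (ratr (f I).2)}.
  apply: (@choice _ _ (fun (I : set R) (p : int * rat) => D I ->
    leb R I = (2 ^ p.1)%:E /\ I (ratr p.2))) => I.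
  have [DI|nDI] := pselect (D I); last by exists (0, 0) => /nDI.
  have [k Ik] := grid_level DI.
  have [|q Iq] := interval_rat (grid_interval DI).
    by rewrite Ik lte_fin pow2_gt0.
  by exists (k, q).
apply/countable_injP; exists (choice.pickle \o f) => I J /[!inE] DI DJ /=.
move=> /(pcan_inj choice.pickleK) fIJ.
have [Ik Iq] := fD _ DI; have [Jk Jq] := fD _ DJ.
by apply: (grid_level_inj DI DJ Ik _ Iq); rewrite fIJ.
Qed.

End grid.

(** * Countable unordered sums and integration *)

Section countable_sums.
Local Open Scope ereal_scope.

(** Turns an unordered countable sum into a series, to which monotone
    convergence applies.  Indices [n] outside [P] are those that enumerate
    nothing, and contribute 0. *)
Lemma countable_esum (R : realType) (T : pointedType) (S : set T) :
  countable S -> exists (g : nat -> T) (P : pred nat),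
    (forall n, P n -> S (g n)) /\
    forall u : T -> \bar R, (forall i, S i -> 0 <= u i) ->
      \esum_(i in S) u i = \sum_(n <oo) (if P n then u (g n) else 0).
Proof.
move=> /countable_injP[h hinj].
pose g n := xget point [set i | S i /\ h i = n].
pose P : set nat := h @` S.
have gP n : P n -> S (g n) /\ h (g n) = n.
  move=> [i Si hi].
  by apply: (@xgetPex _ point [set i | S i /\ h i = n]); exists i.
have gh i : S i -> g (h i) = i.
  move=> Si; have [Sg hg] := gP (h i) (ex_intro2 _ _ i Si erefl).
  by apply: hinj; rewrite ?inE.
exists g, (mem P); split => [n|u u0]; first by rewrite inE => /gP[].
rewrite (@reindex_esum _ _ _ P S g); last first.
  split=> [_ [i Si <-]|n m /[!inE] Pn Pm gnm|i Si] /=.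
  - by rewrite gh.
  - by rewrite -(gP _ Pn).2 -(gP _ Pm).2 gnm.
  - by exists (h i); [exists i|rewrite gh].
rewrite esum_mkcond nneseries_esumT// => n.
by case: ifPn => //; rewrite inE => /gP[/u0].
Qed.

Lemma integral_esum_indic d (T : measurableType d) (R : realType)
    (mu : {measure set T -> \bar R}) (I : pointedType) (S : set I)
    (A : I -> set T) (a : I -> R) :
  countable S -> (forall i, S i -> measurable (A i)) ->
  (forall i, S i -> 0 <= a i)%R ->
  measurable_fun setT (fun x => \esum_(i in S) (a i * \1_(A i) x)%:E) /\
  \int[mu]_x (\esum_(i in S) (a i * \1_(A i) x)%:E) =
    \esum_(i in S) ((a i)%:E * mu (A i)).
Proof.
move=> cS mA a0.
have [g [P [gP gE]]] := countable_esum R cS.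
pose v n x := if P n then (a (g n) * \1_(A (g n)) x)%:E else 0.
have v0 n x : 0 <= v n x.
  rewrite /v; case: ifPn => // Pn; rewrite lee_fin mulr_ge0//.
  by apply: a0; exact: gP.
have mv n : measurable_fun setT (v n).
  have [Pn|Pn] := boolP (P n); last first.
    by rewrite /v (negbTE Pn); exact: measurable_cst.
  rewrite /v Pn; apply/measurable_EFinP.
  by apply: measurable_funM => //; apply/measurable_indic/mA; exact: gP.
have vE x : \esum_(i in S) (a i * \1_(A i) x)%:E = \sum_(n <oo) v n x.
  by rewrite gE// => i Si; rewrite lee_fin mulr_ge0// a0.
split.
  by under eq_fun do rewrite vE; exact: ge0_emeasurable_sum.
under eq_integral do rewrite vE.
rewrite integral_nneseries// gE; last first.
  by move=> i Si; rewrite mule_ge0// lee_fin a0.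
apply: eq_eseriesr => n _; rewrite /v; case: ifPn => Pn; last exact: integral0.
under eq_integral do rewrite EFinM.
rewrite ge0_integralZl_EFin//.
- by rewrite integral_indic ?setIT//; apply: mA; exact: gP.
- by apply/measurable_EFinP/measurable_indic/mA; exact: gP.
- by apply: a0; exact: gP.
Qed.

Lemma esum_ge1 (R : realType) (T : choiceType) (S : set T) (u : T -> \bar R) i :
  (forall j, S j -> 0 <= u j) -> S i -> u i <= \esum_(j in S) u j.
Proof.
move=> u0 Si; apply: esum_ge; exists [set i].
  by split; [exact: finite_set1|move=> _ ->].
by rewrite fsbig_set1.
Qed.

End countable_sums.

Section averages.
Context (R : realType).
Implicit Types (f : R -> R) (I A B : set R).

Definition average f I : R := (len I)^-1 * Rintegral (leb R) I f.

Lemma integrable_cst_on (c : R) A : measurable (A : set (measurableTypeR R)) ->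
  (leb R A < +oo)%E -> (leb R).-integrable A (EFin \o cst c).
Proof.
move=> mA Aoo; apply/integrableP; split.
  by apply/measurable_EFinP; exact: measurable_cst.
have -> : (fun x : measurableTypeR R => `|(EFin \o cst c) x|)%E =
  cst `|c|%:E by [].
by rewrite integral_cst// lte_mul_pinfty.
Qed.

(** On a set of finite measure, [|f| <= f ^+ 2 + 1] is integrable. *)
Lemma Lfun2_integrable_on f A : f \in Lfun (leb R) 2%:E ->
  measurable (A : set (measurableTypeR R)) -> (leb R A < +oo)%E ->
  (leb R).-integrable A (EFin \o f).
Proof.
move=> f2 mA Aoo; have sqf := Lfun2_integrable_sqr f2.
have mf : measurable_fun setT f by move: f2 => /andP[]; rewrite inE.
have iA1 := integrable_cst_on 1 mA Aoo.
have iA2 : (leb R).-integrable A (EFin \o (fun x => f x ^+ 2)).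
  exact: integrableS sqf.
apply: (@le_integrable _ _ _ _ _ mA _ (EFin \o (fun x => f x ^+ 2 + 1))) => //.
- by apply/measurable_EFinP; exact: measurable_funTS.
- move=> x _ /=; rewrite lee_fin [leRHS]ger0_norm ?addr_ge0 ?sqr_ge0//.
  have := sqr_ge0 (`|f x| - 1); rewrite -(real_normK (num_real (f x))).
  by have := normr_ge0 (f x); nra.
- exact: (integrableD mA iA2 iA1).
Qed.

Lemma Lfun2_locally_integrable f : f \in Lfun (leb R) 2%:E ->
  locally_integrable setT f.
Proof.
move=> f2; split; [by move: f2 => /andP[]; rewrite inE|exact: openT|].
move=> K _ cK; have := @Lfun2_integrable_on f K f2 (compact_measurable cK)
  (compact_finite_measure cK).
by move=> /integrableP[].
Qed.

(** Integrate [|f| <= t f^2 + 1/t] over [A], with [t ^ 2 = r] the measure of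
    [A]. *)
Lemma average_le f A (r : R) : f \in Lfun (leb R) 2%:E ->
  measurable (A : set (measurableTypeR R)) -> 0 < r -> leb R A = r%:E ->
  `|average f A| <=
    (Rintegral (leb R) setT (fun x => f x ^+ 2) + 1) * r `^ (- 2^-1).
Proof.
move=> f2 mA r0 Ar.
have Aoo : (leb R A < +oo)%E by rewrite Ar ltry.
have iA := Lfun2_integrable_on f2 mA Aoo.
have sqf := Lfun2_integrable_sqr f2.
have sqfA : (leb R).-integrable A (EFin \o (fun x => f x ^+ 2)).
  exact: integrableS sqf.
set M := Rintegral _ _ _.
pose t := r `^ 2^-1.
have t0 : 0 < t by rewrite powR_gt0.
have tt : t * t = r.
  rewrite -powRD ?(gt_eqF r0) ?implybT// (_ : 2^-1 + 2^-1 = 1); last by lra.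
  by rewrite powRr1 ?ltW.
have MA : Rintegral (leb R) A (fun x => f x ^+ 2) <= M.
  rewrite /M /Rintegral fine_le ?integrable_fin_num//.
  apply: ge0_subset_integral => //.
  - by case/integrableP: sqf.
  - by move=> x _; rewrite lee_fin sqr_ge0.
have isq : (leb R).-integrable A (EFin \o (fun x => t * f x ^+ 2)).
  exact: (integrableZl mA t sqfA).
have le1 : Rintegral (leb R) A (fun x => `|f x|) <=
    Rintegral (leb R) A (fun x => t * f x ^+ 2 + t^-1).
  apply: le_Rintegral => //.
  - exact: integrable_norm.
  - exact: (integrableD mA isq (integrable_cst_on t^-1 mA Aoo)).
  - move=> x _; rewrite -(ler_pM2l t0) mulrDr mulfV ?gt_eqF//.
    rewrite -(real_normK (num_real (f x))).
    have := sqr_ge0 (t * `|f x| - 1).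
    by have := mulr_ge0 (ltW t0) (normr_ge0 (f x)); nra.
rewrite RintegralD ?RintegralZl ?Rintegral_cst// ?Ar/= in le1; last first.
  exact: integrable_cst_on.
rewrite /average normrM ger0_norm ?invr_ge0 ?fine_ge0// /len Ar/= powRN -/t.
have -> : r^-1 * `|Rintegral (leb R) A f| <= (M + 1) * t^-1 =
    (`|Rintegral (leb R) A f| <= t * (M + 1)).
  by rewrite ler_pdivrMl// -{1}tt; congr (_ <= _); field; rewrite gt_eqF.
apply: le_trans (le_normr_Rintegral mA iA) _; apply: le_trans le1 _.
by rewrite -tt mulrA mulVf ?gt_eqF// mul1r mulrDr mulr1 lerD2r ler_pM2l//.
Qed.

Lemma Rintegral_indicB f (c : R) A B :
  measurable (A : set (measurableTypeR R)) ->
  measurable (B : set (measurableTypeR R)) ->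
  (leb R).-integrable A (EFin \o f) -> (leb R).-integrable B (EFin \o f) ->
  Rintegral (leb R) setT (fun x => f x * (c * (\1_A x - \1_B x))) =
  c * (Rintegral (leb R) A f - Rintegral (leb R) B f).
Proof.
move=> mA mB iA iB.
have iA' : (leb R).-integrable setT (EFin \o (f \_ A)).
  by rewrite -restrict_EFin; exact/(integrable_mkcond _ mA).
have iB' : (leb R).-integrable setT (EFin \o (f \_ B)).
  by rewrite -restrict_EFin; exact/(integrable_mkcond _ mB).
rewrite (Rintegral_mkcond (leb R) A f) (Rintegral_mkcond (leb R) B f).
rewrite -RintegralB// -RintegralZl//; last first.
  exact: (integrableB measurableT iA' iB').
by apply: eq_Rintegral => x _; rewrite !patch_indic/=; ring.
Qed.

End averages.

(** * Averages over the intervals of a grid containing a point *)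

Section grid_averages.
Context (R : realType) (D : set (set R)) (gD : dyadic_grid D).
Context (f : R -> R) (f2 : f \in Lfun (leb R) 2%:E).
Implicit Types (I J : set R) (k : int) (x : R).

Lemma grid_integrable I : D I -> (leb R).-integrable I (EFin \o f).
Proof.
move=> DI; have [k Ik] := grid_level gD DI.
apply: Lfun2_integrable_on => //; first exact: grid_measurable gD _ DI.
by rewrite Ik ltry.
Qed.

(** With [r = 2 ^ k], and [a], [b] the integrals of [f] over the half that
    contains [x] and over the other one, both sides are equal to [|a - b| / r]:
    on the left it is [2 a / r - (a + b) / r]. *)
Lemma average_increment k x :
  `|average f (cell D (k - 1) x) - average f (cell D k x)| =
  (2 ^ k) `^ (- 2^-1) * `|inner f (haar D (cell D k x))|.
Proof.
have [DI Ik Ix] := cellP gD k x; have [DJ Jk Jx] := cellP gD (k - 1) x.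
have [K [DK JK0 IJK hE]] := cell_halves gD k x.
have mJ := grid_measurable gD DJ; have mK := grid_measurable gD DK.
have iJ := grid_integrable DJ; have iK := grid_integrable DK.
have fI : Rintegral (leb R) (cell D k x) f =
    Rintegral (leb R) (cell D (k - 1) x) f + Rintegral (leb R) K f.
  rewrite IJK Rintegral_setU//; first by rewrite -IJK; exact: grid_integrable.
  by apply/disj_set2P.
have r0 : 0 < 2 ^ k :> R by exact: pow2_gt0.
have innerE : `|inner f (haar D (cell D k x))| = (2 ^ k) `^ (- 2^-1) *
    `|Rintegral (leb R) (cell D (k - 1) x) f - Rintegral (leb R) K f|.
  rewrite /inner /haar (level_len Ik).
  by case: hE => -[-> ->]; rewrite Rintegral_indicB// normrM
    (ger0_norm (powR_ge0 _ _))// distrC.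
rewrite innerE mulrA -powRD ?(gt_eqF r0) ?implybT//.
have -> : - 2^-1 + - 2^-1 = -1 :> R by lra.
rewrite powR_inv1 ?ltW// /average (level_len Ik) (level_len Jk) fI.
rewrite -[X in X * `|_|]ger0_norm ?invr_ge0 ?ltW// -normrM; congr `|_|.
have r0' : 0 < 2 ^ (k - 1) :> R by exact: pow2_gt0.
by rewrite (pow2_half _ k); field; rewrite !gt_eqF ?addr_gt0.
Qed.

(** By [average_le] the averages are [O(2 ^ (- k / 2))]. *)
Lemma average_cvg0 x (N : int) :
  average f (cell D (N + n%:Z) x) @[n --> \oo] --> 0.
Proof.
set M := Rintegral (leb R) setT (fun y => f y ^+ 2) + 1.
pose u (n : nat) : R := M * (2 ^ N) `^ (- 2^-1) * (2 `^ (- 2^-1)) ^+ n.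
have u0 : u @ \oo --> 0.
  apply: cvg_geometric; rewrite ger0_norm ?powR_ge0//.
  by apply: powR2_lt1; rewrite oppr_lt0.
apply: norm_cvg0; apply: (squeeze_cvgr _ (cvg_cst 0) u0).
apply: nearW => n; rewrite normr_ge0/= /u -mulrA -dyadic_powR.
have [DI Ik Ix] := cellP gD (N + n%:Z) x.
by apply: average_le => //; [exact: grid_measurable gD _ DI|exact: pow2_gt0].
Qed.

Lemma grid_diam I k x y : D I -> leb R I = (2 ^ k)%:E -> I x -> I y ->
  `|x - y| <= 2 ^ k.
Proof.
move=> DI Ik; wlog xy : x y / x <= y => [wl|Ix Iy].
  by have [/wl//|/ltW/wl yx Ix Iy] := leP x y; rewrite distrC; exact: yx.
rewrite distrC ger0_norm ?subr_ge0// -lee_fin -Ik.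
have -> : (y - x)%:E = leb R [set` `[x, y]].
  have -> : leb R [set` `[x, y]] = _ := lebesgue_measure_itv `[x, y].
  rewrite /= lte_fin; move: xy.
  by rewrite le_eqVlt => /predU1P[->|->]; rewrite ?ltxx ?subrr.
rewrite le_measure ?inE//; first exact: grid_measurable gD _ DI.
by move=> z /=; rewrite in_itv/=; exact: (grid_interval gD DI).
Qed.

(** An interval of length [l] containing [x] lies in the open ball of centre [x]
    and radius [2 l], whose measure is [4 l]. *)
Lemma cell_nicely_shrinking (N : int) x :
  nicely_shrinking x (fun n => cell D (N - n%:Z) x).
Proof.
split=> [n|].
  by have [DI _ _] := cellP gD (N - n%:Z) x; exact: grid_measurable gD _ DI.
have r0 n : 0 < 2 * 2 ^ (N - n%:Z) :> R by rewrite mulr_gt0// pow2_gt0.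
exists (4, fun n => PosNum (r0 n)); split => //=.
- have -> : (fun n => 2 * 2 ^ (N - n%:Z)) =
      (fun n => 2 * 2 ^ N * (2^-1) ^+ n) :> (nat -> R).
    apply/funext => n.
    have := dyadic_powRN N n (1 : R); rewrite !powRr1 ?ltW ?pow2_gt0// => ->.
    by rewrite powR_inv1// mulrA.
  by apply: cvg_geometric; rewrite ger0_norm ?invr_ge0// invf_lt1// ltr1n.
- move=> n y Iy; have [DI Ik Ix] := cellP gD (N - n%:Z) x.
  rewrite /ball/= (@le_lt_trans _ _ (2 ^ (N - n%:Z)))//; last first.
    by rewrite ltr_pMl ?pow2_gt0// ltr1n.
  exact: grid_diam DI Ik Ix Iy.
- move=> n; have [DI Ik Ix] := cellP gD (N - n%:Z) x.
  have -> : lebesgue_measure (cell D (N - n%:Z) x) = (2 ^ (N - n%:Z))%:E := Ik.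
  rewrite lebesgue_measure_ball ?(ltW (r0 n))//= -EFinM lee_fin.
  by rewrite -[leLHS]mulr_natl mulrA -natrM.
Qed.

(** The exceptional null set, that of the points that are not Lebesgue points of
    [f], is the same for all [N]. *)
Lemma ae_average_cvg :
  {ae leb R, forall x, forall N : int,
    average f (cell D (N - n%:Z) x) @[n --> \oo] --> f x}.
Proof.
have lf := Lfun2_locally_integrable f2.
have [Z [mZ Z0 fZ]] := lebesgue_differentiation lf.
exists Z; split => // x /= nx; apply: fZ => fx; apply: nx => N.
have := nice_lebesgue_differentiation (cell_nicely_shrinking N) lf fx.
move=> /fine_cvgP[_]; apply: cvg_trans; apply: near_eq_cvg.
apply: nearW => n /=.
have [DI Ik Ix] := cellP gD (N - n%:Z) x.
have -> : (\int[lebesgue_measure]_(y in cell D (N - n%:Z) x) (f y)%:E)%E =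
    (Rintegral (leb R) (cell D (N - n%:Z) x) f)%:E.
  rewrite /Rintegral fineK//.
  exact: (integrable_fin_num (grid_measurable gD DI) (grid_integrable DI)).
have -> : lebesgue_measure (cell D (N - n%:Z) x) = (2 ^ (N - n%:Z))%:E := Ik.
by rewrite inver gt_eqF ?pow2_gt0// /average (level_len Ik).
Qed.

End grid_averages.

(** * The Sobolev inequality in L^2 *)

Section sobolev.
Context (R : realType) (s : R) (s0 : 0 < s) (s1 : s < 2^-1).
Context (D : set (set R)) (gD : dyadic_grid D).
Implicit Types (f : R -> R) (I : set R) (k : int) (x : R).

Definition energy_weight f I : R :=
  len I `^ (- (2 * s)) * `|inner f (haar D I)| ^+ 2.

(** A localized form of the energy: the term of each interval [I] is spread
    uniformly over [I]. *)
Definition energy_density f x : \bar R :=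
  \esum_(I in D) (energy_weight f I / len I * \1_I x)%:E.

Lemma energy_weight_ge0 f I : 0 <= energy_weight f I.
Proof. by rewrite mulr_ge0 ?powR_ge0// sqr_ge0. Qed.

Lemma len_ge0 I : 0 <= len I.
Proof. by rewrite fine_ge0. Qed.

Lemma energy_density_ge0 f x : (0 <= energy_density f x)%E.
Proof.
apply: esum_ge0 => I _; rewrite lee_fin mulr_ge0//.
by rewrite divr_ge0 ?energy_weight_ge0 ?len_ge0.
Qed.

Lemma energy_density_integral f :
  measurable_fun setT (energy_density f : measurableTypeR R -> \bar R) /\
  (\int[leb R]_x energy_density f x = haar_energy D s f)%E.
Proof.
have [|I DI|mW ->] := @integral_esum_indic _ (measurableTypeR R) R (leb R) _ D
  id (fun I => energy_weight f I / len I) (grid_countable gD).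
- by move=> I; exact: grid_measurable.
- by rewrite divr_ge0 ?energy_weight_ge0 ?len_ge0.
split => //; apply: eq_esum => I DI.
have [k Ik] := grid_level gD DI.
by rewrite Ik -EFinM -(level_len Ik) divfK // (level_len Ik) gt_eqF ?pow2_gt0.
Qed.

Lemma le_of_sqr_powR (b c r t : R) : 0 <= b ->
  r `^ (2 * t) * c ^+ 2 <= b ^+ 2 -> r `^ t * c <= b.
Proof.
move=> b0; rewrite (mulrC 2) powRrM powR_mulrn ?powR_ge0// -exprMn => h.
apply: le_trans (ler_norm _) _.
by rewrite -ler_sqr ?nnegrE// real_normK ?num_real.
Qed.

(** Positive upper bounds [G] and [e] replace the square roots of the density
    and of the energy, which may vanish. *)
Lemma sobolev_pointwise f x (G e : R) : f \in Lfun (leb R) 2%:E ->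
  0 < G -> 0 < e ->
  (energy_density f x <= (G ^+ 2)%:E)%E ->
  (haar_energy D s f <= (e ^+ 2)%:E)%E ->
  (forall N : int, average f (cell D (N - n%:Z) x) @[n --> \oo] --> f x) ->
  `|f x| <= sobolev_const s * (G `^ (1 - 2 * s) * e `^ (2 * s)).
Proof.
move=> f2 G0 e0 WG Ee fx.
apply: (@dyadic_interpolation _ s G e (f x)
  (fun k => average f (cell D k x))) => //.
(* the term of [cell D k x] in the density at [x] *)
- move=> k; rewrite average_increment//.
  have [DI Ik Ix] := cellP gD k x; set I := cell D k x in DI Ik Ix *.
  have r0 : 0 < 2 ^ k :> R by exact: pow2_gt0.
  set c := `|inner f (haar D I)|.
  have -> : (2 ^ k) `^ (- 2^-1) * c =
      (2 ^ k) `^ (- s - 2^-1) * c * (2 ^ k) `^ s.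
    rewrite mulrAC -powRD ?(gt_eqF r0) ?implybT//.
    by congr (_ `^ _ * _); ring.
  rewrite ler_pM2r ?powR_gt0//; apply: le_of_sqr_powR; first exact: ltW.
  rewrite -lee_fin; apply: le_trans WG.
  apply: le_trans (esum_ge1 _ DI); last first.
    move=> J _; rewrite lee_fin mulr_ge0//.
    by rewrite divr_ge0 ?energy_weight_ge0 ?len_ge0.
  rewrite lee_fin indicE mem_set// mulr1 /energy_weight (level_len Ik) -/c.
  rewrite mulrAC ler_wpM2r ?sqr_ge0// -(powR_inv1 (ltW r0)).
  rewrite -powRD ?(gt_eqF r0) ?implybT//.
  by have -> : 2 * (- s - 2^-1) = - (2 * s) + -1 by field.
(* the term of [cell D k x] in the energy *)
- move=> k; rewrite average_increment//.
  have [DI Ik Ix] := cellP gD k x; set I := cell D k x in DI Ik Ix *.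
  have r0 : 0 < 2 ^ k :> R by exact: pow2_gt0.
  set c := `|inner f (haar D I)|.
  have -> : (2 ^ k) `^ (- 2^-1) * c =
      (2 ^ k) `^ (- s) * c * (2 ^ k) `^ (s - 2^-1).
    rewrite mulrAC -powRD ?(gt_eqF r0) ?implybT//.
    by congr (_ `^ _ * _); ring.
  rewrite ler_pM2r ?powR_gt0//; apply: le_of_sqr_powR; first exact: ltW.
  rewrite -lee_fin; apply: le_trans Ee.
  apply: le_trans (esum_ge1 _ DI); last first.
    by move=> J _; rewrite lee_fin; exact: energy_weight_ge0.
  by rewrite lee_fin (level_len Ik) mulrN.
- by move=> N; exact: average_cvg0.
Qed.

Let q : R := 2 / (1 - 2 * s).

Lemma sobolev_denom_gt0 : 0 < 1 - 2 * s.
Proof. by have := s1; lra. Qed.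

Lemma sobolev_q_gt0 : 0 < q.
Proof. by rewrite divr_gt0// sobolev_denom_gt0. Qed.

(** Take [G ^ 2] decreasing to the density in [sobolev_pointwise], raised to the
    power [q]: since [q (1 - 2 s) = 2], the bound becomes linear in [G ^ 2]. *)
Lemma sobolev_density f x (e : R) : f \in Lfun (leb R) 2%:E -> 0 < e ->
  (haar_energy D s f <= (e ^+ 2)%:E)%E ->
  (forall N : int, average f (cell D (N - n%:Z) x) @[n --> \oo] --> f x) ->
  ((`|f x| `^ q)%:E <=
    (sobolev_const s `^ q * e `^ (2 * s * q))%:E * energy_density f x)%E.
Proof.
move=> f2 e0 Ee fx; have q0 := sobolev_q_gt0.
have K0 := sobolev_const_gt0 s0 s1.
set c := _ * _; have c0 : 0 < c by rewrite mulr_gt0 ?powR_gt0.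
have W0 := energy_density_ge0 f x.
move: W0 (@sobolev_pointwise f x).
case: (energy_density f x) => [w||]//; last first.
  by move=> _ _; rewrite gt0_muley ?lte_fin// leey.
rewrite lee_fin => w0 pw.
rewrite -EFinM lee_fin; apply/ler_addgt0Pr => eps eps0.
pose t := w + eps / c.
have t0 : 0 < t by rewrite /t addrC ltr_wpDr// divr_gt0.
have -> : c * w + eps = c * t by rewrite /t mulrDr mulrCA mulfV ?mulr1// gt_eqF.
have := pw (t `^ 2^-1) e f2 (powR_gt0 _ t0) e0 _ Ee fx.
have tE : t `^ 2^-1 ^+ 2 = t.
  by rewrite -powR_mulrn ?powR_ge0// -powRrM mulVf// powRr1 ?ltW.
rewrite tE lee_fin lerDl (divr_ge0 (ltW eps0) (ltW c0)) => /(_ isT) fle.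
apply: (@le_trans _ _ ((sobolev_const s *
  ((t `^ 2^-1) `^ (1 - 2 * s) * e `^ (2 * s))) `^ q)).
  by rewrite ge0_ler_powR ?(ltW q0)// nnegrE// !mulr_ge0 ?powR_ge0 ?(ltW K0).
rewrite powRM ?mulr_ge0 ?powR_ge0 ?(ltW K0)// powRM ?powR_ge0// -!powRrM.
have -> : 2^-1 * ((1 - 2 * s) * q) = 1.
  by rewrite /q; field; rewrite gt_eqF// sobolev_denom_gt0.
by rewrite powRr1 ?(ltW t0)// [t * _]mulrC mulrA.
Qed.

(** Integrate [sobolev_density]; the powers of [e] add up to
    [2 s q + 2 = q]. *)
Lemma sobolev_Lnorm_le f (e : R) : f \in Lfun (leb R) 2%:E -> 0 < e ->
  (haar_energy D s f <= (e ^+ 2)%:E)%E ->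
  ('N[leb R]_(q%:E)[EFin \o f] <= (sobolev_const s * e)%:E)%E.
Proof.
move=> f2 e0 Ee; have q0 := sobolev_q_gt0.
have K0 := sobolev_const_gt0 s0 s1.
have [mW intW] := energy_density_integral f.
have mf : measurable_fun setT f by move: f2 => /andP[]; rewrite inE.
have W0 := energy_density_ge0 f.
set c := sobolev_const s `^ q * e `^ (2 * s * q).
have c0 : 0 < c by rewrite mulr_gt0 ?powR_gt0.
have intf : (\int[leb R]_x (`|f x| `^ q)%:E <= c%:E * (e ^+ 2)%:E)%E.
  apply: (@le_trans _ _ (\int[leb R]_x (c%:E * energy_density f x))%E).
    apply: ae_ge0_le_integral => //.
    - apply/measurable_EFinP.
      apply: (@measurableT_comp _ _ _ _ _ _ (fun y : R => y `^ q)) => //.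
      exact: measurableT_comp.
    - by move=> x _; rewrite mule_ge0// lee_fin ltW.
    - exact: measurable_funeM.
    - have [Z [mZ Z0 fZ]] := ae_average_cvg gD f2.
      exists Z; split => // x /= nx; apply: fZ => fx; apply: nx => _.
      exact: sobolev_density.
  rewrite ge0_integralZl_EFin ?(ltW c0)//.
  by rewrite intW lee_pmul2l.
have Ke0 : 0 < sobolev_const s * e by rewrite mulr_gt0.
have -> : sobolev_const s * e = ((sobolev_const s * e) `^ q) `^ q^-1.
  by rewrite -powRrM mulfV ?gt_eqF// powRr1 ?ltW.
rewrite unlock -poweR_EFin; apply: gt0_ler_poweR.
- by rewrite invr_ge0 ltW.
- by rewrite in_itv/= leey integral_ge0.
- by rewrite in_itv/= leey lee_fin powR_ge0.
apply: (le_trans intf); rewrite -EFinM lee_fin /c -(mulrA (_ `^ q)).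
rewrite powRM ?(ltW K0) ?(ltW e0)//.
rewrite ler_pM2l ?powR_gt0// -powR_mulrn ?(ltW e0)//.
rewrite -powRD ?(gt_eqF e0) ?implybT//.
suff -> : 2 * s * q + 2%:R = q by [].
by rewrite /q; field; rewrite gt_eqF// sobolev_denom_gt0.
Qed.

(** Let [e] decrease to the homogeneous norm in [sobolev_Lnorm_le]; when the
    energy is infinite, so is the right-hand side. *)
Lemma sobolev_hdot f : f \in Lfun (leb R) 2%:E ->
  ('N[leb R]_(q%:E)[EFin \o f] <= (sobolev_const s)%:E * hdot_norm D s f)%E.
Proof.
move=> f2; have K0 := sobolev_const_gt0 s0 s1.
have E0 : (0 <= haar_energy D s f)%E.
  by apply: esum_ge0 => I _; rewrite lee_fin; exact: energy_weight_ge0.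
move: E0 (@sobolev_Lnorm_le f); rewrite /hdot_norm.
case: (haar_energy D s f) => [E||]//; last first.
  by move=> _ _; rewrite poweRyr ?invr_eq0// gt0_muley ?lte_fin// leey.
rewrite lee_fin => E0 le; rewrite poweR_EFin.
apply/lee_addgt0Pr => eps eps0.
pose e := E `^ 2^-1 + eps / sobolev_const s.
have e0 : 0 < e by rewrite /e ltr_wpDl ?powR_ge0 ?divr_gt0.
rewrite -EFinM -EFinD.
have -> : sobolev_const s * E `^ 2^-1 + eps = sobolev_const s * e.
  by rewrite /e; field; rewrite gt_eqF.
apply: le => //; rewrite lee_fin.
have -> : E = (E `^ 2^-1) ^+ 2.
  by rewrite -powR_mulrn ?powR_ge0// -powRrM mulVf// powRr1.
rewrite ler_sqr ?nnegrE ?powR_ge0// ?(ltW e0)// lerDl.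
by rewrite divr_ge0 ?(ltW eps0) ?(ltW K0).
Qed.

End sobolev.

(** * Haar polynomials and the embedding *)

Lemma indic_Lfun2 (R : realType) (A : set R) :
  measurable (A : set (measurableTypeR R)) -> (leb R A < +oo)%E ->
  (\1_A : R -> R) \in Lfun (leb R) 2%:E.
Proof.
move=> mA Aoo; apply/andP; split; rewrite inE/=.
  exact: measurable_indic.
rewrite /finite_norm unlock poweR_lty//.
rewrite (_ : (fun x => _) = (fun x => (\1_A x)%:E)); last first.
  apply/funext => x /=; rewrite ger0_norm// powR_mulrn// indicE.
  by case: (x \in A); rewrite ?expr1n ?expr0n.
by rewrite integral_indic// setIT.
Qed.

Lemma haar_span_Lfun2 (R : realType) (D : set (set R)) (f : R -> R) :
  dyadic_grid D -> haar_span D f -> f \in Lfun (leb R) 2%:E.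
Proof.
move=> gD [n [I [c [DI ->]]]].
have two1 : (1 <= 2%:E :> \bar R)%E by rewrite lee_fin ler1n.
have [L0 Llin] := Lfun_submod_closed (leb R) two1.
have haar2 J : D J -> haar D J \in Lfun (leb R) 2%:E.
  move=> DJ; have [k Jk] := grid_level gD DJ; have [x Jx] := grid_neq0 gD DJ.
  have cJ := cellE gD DJ Jk Jx.
  have [DP Pk _] := cellP gD (k - 1) x.
  have [K [DK _ _ hE]] := cell_halves gD k x; rewrite cJ in hE.
  have ind2 L : D L -> (\1_L : R -> R) \in Lfun (leb R) 2%:E.
    move=> DL; apply: indic_Lfun2; first exact: grid_measurable gD _ DL.
    by have [m ->] := grid_level gD DL; rewrite ltry.
  have diff2 A B : D A -> D B ->
      (fun x => len J `^ (- 2^-1) * (\1_A x - \1_B x)) \in Lfun (leb R) 2%:E.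
    move=> /ind2 iA /ind2 iB.
    have -> : (fun x => len J `^ (- 2^-1) * (\1_A x - \1_B x)) =
        len J `^ (- 2^-1) *: (-1 *: (\1_B : R -> R) + \1_A) + 0.
      apply/funext => y.
      by rewrite addr0 scaleN1r addrC.
    exact: (Llin _ _ _ (Llin _ _ _ iB iA) L0).
  by rewrite /haar; case: hE => -[-> ->]; exact: diff2.
elim: n I c DI => [|n IHn] I c DI.
  by under eq_fun do rewrite big_ord0.
under eq_fun do rewrite big_ord_recl.
exact: (Llin (c ord0) _ _ (haar2 _ (DI ord0)) (IHn _ _ (fun i => DI _))).
Qed.

Theorem proposition5 (R : realType) (s : R) (hs0 : 0 < s) (hs1 : s < 1 / 2) :
  let q : R := 2 / (1 - 2 * s) in
  (forall D : set (set R), dyadic_grid D ->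
     forall f : R -> R, Hs D s f -> f \in Lfun (leb R) q%:E) /\
  (exists C : R, 0 < C /\
     forall D : set (set R), dyadic_grid D ->
     forall f : R -> R, haar_span D f ->
       ('N[leb R]_(q%:E)[EFin \o f] <= C%:E * hdot_norm D s f)%E).
Proof.
move=> q; have s1 : s < 2^-1 by rewrite -div1r.
have K0 := sobolev_const_gt0 hs0 s1.
split=> [D gD f [f2 Efin]|].
  apply/andP; split; first by case/andP: f2.
  rewrite inE /= /finite_norm.
  apply: le_lt_trans (sobolev_hdot hs0 s1 gD f2) _.
  apply: lte_mul_pinfty; rewrite ?lee_fin ?ltW//.
  exact: poweR_lty.
exists (sobolev_const s); split => // D gD f fD.
exact: sobolev_hdot (haar_span_Lfun2 gD fD).
Qed.
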